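(* For every integer $n\geq 2$ there exists a finite Krasner hyperfield $(R,\oplus,\cdot,0,1)$ of order $n$, i.e. whose underlying set $R$ has exactly $n$ elements.
   Context: For a non-empty set $R$, let $\mathcal{P}^*(R)$ denote the set of all non-empty subsets of $R$. A hyperoperation on $R$ is a map $\oplus: R\times R\to \mathcal{P}^*(R)$, $(x,y)\mapsto x\oplus y$. It is extended to subsets: for non-empty $A,B\subseteq R$ and $x \in R$, $A\oplus B=\bigcup_{a\in A,\,b\in B} a\oplus b$, $x\oplus A=\{x\}\oplus A$, and $A\oplus x=A\oplus\{x\}$. A canonical hypergroup is a pair $(R,\oplus)$, with $R$ a non-empty set and $\oplus$ a hyperoperation on $R$, such that: 1. for all $x,y,z\in R$, $x\oplus(y\oplus z)=(x\oplus y)\oplus z$; 2. for all $x,y\in R$, $x\oplus y=y\oplus x$; 3. there exists $0\in R$ (additive identity) such that $0\oplus x=\{x\}$ for every $x\in R$; 4. for every $x\in R$ there exists a unique element $x'\in R$ (the opposite of $x$) such that $0\in x\oplus x'$; 5. for all $x,y,z\in R$, $z\in x\oplus y$ implies $y\in x'\oplus z$ and $x\in z\oplus y'$. A Krasner hyperring is a triple $(R,\oplus,\cdot)$, where $\cdot: R\times R\to R$ is an ordinary (single-valued) binary operation, such that: 1. $(R,\oplus)$ is a canonical hypergroup with additive identity $0$; 2. $(R,\cdot)$ is a semigroup having $0$ as a bilaterally absorbing element, i.e. $x\cdot 0=0\cdot x=0$ for all $x\in R$; 3. $\cdot$ is left and right distributive over $\oplus$: for all $x,y,z\in R$, $x\cdot(y\oplus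 z)=(x\cdot y)\oplus(x\cdot z)$ and $(y\oplus z)\cdot x=(y\cdot x)\oplus(z\cdot x)$, where $x\cdot A=\{x\cdot a : a\in A\}$ and $A\cdot x=\{a\cdot x: a\in A\}$ for $A\subseteq R$. A Krasner hyperring is commutative with unit element $1$ if $(R,\cdot)$ is a commutative semigroup with unit element $1$; it is then denoted $(R,\oplus,\cdot,0,1)$. A Krasner hyperfield is a commutative Krasner hyperring with unit $(R,\oplus,\cdot,0,1)$ such that $(R\setminus\{0\},\cdot,1)$ is a group. *)

(* Defs.v *)
From mathcomp Require Import all_boot.
From mathcomp Require Import classical_sets.

Set Implicit Arguments.
Unset Strict Implicit.
Unset Printing Implicit Defensive.

Local Open Scope classical_set_scope.

Definition hyperop_set (R : Type) (add : R -> R -> set R) (A B : set R)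
  : set R :=
  \bigcup_(a in A) \bigcup_(b in B) add a b.

Definition is_hyperoperation (R : Type) (add : R -> R -> set R) : Prop :=
  forall x y : R, add x y !=set0.

Definition is_opposite (R : Type) (add : R -> R -> set R) (zero x x' : R)
  : Prop :=
  add x x' zero.

Record is_canonical_hypergroup (R : Type) (add : R -> R -> set R) (zero : R)
  : Prop := {
  chg_hyperop : is_hyperoperation add;
  chg_addA : forall x y z : R,
    hyperop_set add [set x] (add y z) = hyperop_set add (add x y) [set z];
  chg_addC : forall x y : R, add x y = add y x;
  chg_add0 : forall x : R, add zero x = [set x];
  chg_opp : forall x : R, exists! x' : R, is_opposite add zero x x';
  (* [x'] and [y'] range over the opposites of [x] and [y], which exist and
     are unique by [chg_opp]. *)
  chg_reversible : forall x y z x' y' : R,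
    is_opposite add zero x x' -> is_opposite add zero y y' ->
    add x y z -> add x' z y /\ add z y' x
}.

Record is_krasner_hyperring (R : Type) (add : R -> R -> set R)
    (mul : R -> R -> R) (zero : R) : Prop := {
  khr_add : is_canonical_hypergroup add zero;
  khr_mulA : associative mul;
  khr_mul0 : right_zero zero mul;
  khr_0mul : left_zero zero mul;
  khr_mulDr : forall x y z : R,
    [set mul x a | a in add y z] = add (mul x y) (mul x z);
  khr_mulDl : forall x y z : R,
    [set mul a x | a in add y z] = add (mul y x) (mul z x)
}.

Record is_comm_unit_krasner_hyperring (R : Type) (add : R -> R -> set R)
    (mul : R -> R -> R) (zero one : R) : Prop := {
  ckhr_hyperring : is_krasner_hyperring add mul zero;
  ckhr_mulC : commutative mul;
  ckhr_1mul : left_id one mul;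
  ckhr_mul1 : right_id one mul
}.

Record is_group_on (R : Type) (G : set R) (mul : R -> R -> R) (one : R)
  : Prop := {
  grp_closed : forall x y : R, G x -> G y -> G (mul x y);
  grp_one : G one;
  grp_mulA : forall x y z : R, G x -> G y -> G z ->
    mul x (mul y z) = mul (mul x y) z;
  grp_1mul : forall x : R, G x -> mul one x = x;
  grp_mul1 : forall x : R, G x -> mul x one = x;
  grp_inv : forall x : R, G x ->
    exists y : R, [/\ G y, mul y x = one & mul x y = one]
}.

Record is_krasner_hyperfield (R : Type) (add : R -> R -> set R)
    (mul : R -> R -> R) (zero one : R) : Prop := {
  khf_hyperring : is_comm_unit_krasner_hyperring add mul zero one;
  khf_group : is_group_on (~` [set zero]) mul one
}.

(* Main.v *)
(** For any abelian group [G], the set [G] with a zero adjoined is a Krasner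
    hyperfield under [a + a = G ∪ {0}] and [a + b = {a, b}] for [a <> b] in [G].
    Every sum in which an element of [G] is repeated is the whole set, and a sum
    of distinct elements of [G] is the set of its terms, however it is bracketed.
    A cyclic group of order [n - 1] then gives order [n]. *)
Require Import Defs.
From mathcomp Require Import all_boot all_algebra.
From mathcomp Require Import classical_sets.

Set Implicit Arguments.
Unset Strict Implicit.
Unset Printing Implicit Defensive.

Local Open Scope classical_set_scope.

(* The group is written additively: [None] is the zero of the hyperfield and
   [Some 0] is its unit. *)
Section AdjoinZero.
Variable G : zmodType.
Implicit Types x y z u w : option G.

(** The disjunct [a = b] does not mention [z]: if true it makes the sum the whole set, if false it
    leaves the pair of terms. *)
Definition hadd x y : set (option G) := fun z =>
  match x, y with
  | None, _ => z = y
  | _, None => z = x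
  | Some a, Some b => [\/ a = b, z = x | z = y]
  end.

Definition hmul x y : option G :=
  match x, y with
  | Some a, Some b => Some (a + b)%R
  | _, _ => None
  end.

Lemma haddC x y : hadd x y = hadd y x.
Proof.
apply/seteqP; case: x y => [a|] [b|]; split=> z //=;
  by case=> ->; by [apply: Or31 | apply: Or32 | apply: Or33].
Qed.

Lemma hadd_self (a : G) z : hadd (Some a) (Some a) z.
Proof. exact: Or31. Qed.

(** Only one inclusion of associativity is proved by cases; commutativity turns it into the
    other. *)
Lemma hadd_assoc_witness x y z u w :
  hadd y z u -> hadd x u w -> exists2 v, hadd x y v & hadd v z w.
Proof.
case: x => [a|] /=; last by move=> yzu ->; exists y.
case: y => [b|] /=; last by move=> -> ?; exists (Some a).
case: z => [c|]; last by move=> -> abw; exists w => //; case: (w).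
(* In each of the three coincidences [v = Some c] lies in the sum of [a] and [b], and its sum with
   [c] is everything. *)
have [<- _ _|neq_ab] := eqVneq a b.
  by exists (Some c); [exact: Or31 | exact: hadd_self].
have [<- _ _|neq_ac] := eqVneq a c.
  by exists (Some a); [exact: Or32 | exact: hadd_self].
have [<- _ _|neq_bc] := eqVneq b c.
  by exists (Some b); [exact: Or33 | exact: hadd_self].
(* For distinct [a], [b], [c], the element [w] is one of the three. *)
have wa : w = Some a -> exists2 v, hadd (Some a) (Some b) v & hadd v (Some c) w.
  by move=> ->; exists (Some a); exact: Or32.
have wb : w = Some b -> exists2 v, hadd (Some a) (Some b) v & hadd v (Some c) w.
  by move=> ->; exists (Some b); [exact: Or33 | exact: Or32].
have wc : w = Some c -> exists2 v, hadd (Some a) (Some b) v & hadd v (Some c) w.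
  by move=> ->; exists (Some a); [exact: Or32 | exact: Or33].
case=> [/eqP|->|->]; first by rewrite (negPf neq_bc).
- by case=> [/eqP| |] //; rewrite (negPf neq_ab).
- by case=> [/eqP| |] //; rewrite (negPf neq_ac).
Qed.

Lemma haddA x y z :
  hyperop_set hadd [set x] (hadd y z) = hyperop_set hadd (hadd x y) [set z].
Proof.
apply/seteqP; split=> w.
  case=> _ -> [u yzu xuw]; have [v xyv vzw] := hadd_assoc_witness yzu xuw.
  by exists v => //; exists z.
case=> v xyv [_ -> vzw].
(* The first inclusion is applied to the reversed triple [z], [y], [x]. *)
have [u zyu uxw] : exists2 u, hadd z y u & hadd u x w.
  by apply: (@hadd_assoc_witness _ _ _ v); rewrite haddC.
by exists x => //; exists u; rewrite haddC.
Qed.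

(** A sum of two nonzero elements contains zero only if they are equal, so opposites are trivial. *)
Lemma hadd_opp x x' : is_opposite hadd None x x' <-> x' = x.
Proof.
rewrite /is_opposite; case: x x' => [a|] [b|] //=; split=> //.
  by case=> // ->.
by move=> [->]; exact: Or31.
Qed.

(** Among nonzero elements, membership in a sum says that two of the three coincide, which is
    symmetric in them. As opposites are trivial, this is reversibility. *)
Lemma hadd_rev x y z : hadd x y z -> hadd x z y.
Proof.
case: x y z => [a|] [b|] [c|] //=.
- by case=> [->|[->]|[->]]; [exact: Or32 | exact: Or31 | exact: Or33].
- by case=> // ->.
- by move=> [->]; exact: Or31.
Qed.

Lemma hadd_canonical : is_canonical_hypergroup hadd None.
Proof.
split.
- case=> [a|] [b|]; [exists (Some a); exact: Or32 | by eexists ..].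
- exact: haddA.
- exact: haddC.
- by move=> x; apply/seteqP; split.
- move=> x; exists x; split; first exact/hadd_opp.
  by move=> x' /hadd_opp.
- move=> x y z _ _ /hadd_opp-> /hadd_opp-> xyz; split; first exact: hadd_rev.
  by rewrite haddC; apply: hadd_rev; rewrite haddC.
Qed.

Lemma hmulC : commutative hmul.
Proof. by case=> [a|] [b|] //=; rewrite GRing.addrC. Qed.

Lemma hmulA : associative hmul.
Proof. by case=> [a|] [b|] [c|] //=; rewrite GRing.addrA. Qed.

Lemma hmulDr x y z :
  [set hmul x t | t in hadd y z] = hadd (hmul x y) (hmul x z).
Proof.
apply/seteqP; split=> w.
  case=> t yzt <-; case: x y z t yzt => [a|] [b|] [c|] [d|] //=.
  - by case=> [->|[->]|[->]]; [exact: Or31 | exact: Or32 | exact: Or33].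
  - by case=> // ->; exact: Or31.
  - by move=> [->].
  - by move=> [->].
case: x => [a|].
  (* Multiplication by a nonzero element is invertible, so the preimage of [w] is its quotient by
     [a]. *)
  move=> yzw; exists (hmul (Some (- a)%R) w); last first.
    by case: w {yzw} => //= d; rewrite GRing.addNKr.
  case: y z w yzw => [b|] [c|] [d|] //=.
  - case=> [/GRing.addrI->|[->]|[->]]; rewrite ?GRing.addKr;
      by [exact: Or31 | exact: Or32 | exact: Or33].
  - by case=> // /GRing.addrI->; exact: Or31.
  - by move=> [->]; rewrite GRing.addKr.
  - by move=> [->]; rewrite GRing.addKr.
(* For [x] zero, the image contains zero because the sum of [y] and [z] is nonempty. *)
move=> /= ->; have [t yzt] := chg_hyperop hadd_canonical y z.
by exists t.
Qed.

Lemma adjoin_zero_hyperfield :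
  is_krasner_hyperfield hadd hmul None (Some 0%R).
Proof.
have mul1 : left_id (Some 0%R) hmul by case=> //= a; rewrite GRing.add0r.
have mulr1 : right_id (Some 0%R) hmul by move=> x; rewrite hmulC mul1.
split; split=> //.
- split; first exact: hadd_canonical.
  + exact: hmulA.
  + by case.
  + by case.
  + exact: hmulDr.
  + move=> x y z; rewrite !(hmulC _ x) -hmulDr.
    by under eq_imagel do rewrite hmulC.
- exact: hmulC.
- by case=> [a|] [b|].
- by move=> x y z _ _ _; exact: hmulA.
- case=> [a _|/(_ erefl)] //; exists (Some (- a)%R).
  by rewrite /= GRing.addNr GRing.addrN.
Qed.

End AdjoinZero.

Theorem theorem3p1 (n : nat) (hn : 2 <= n) :
  exists (R : finType) (add : R -> R -> set R) (mul : R -> R -> R)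
    (zero one : R),
    is_krasner_hyperfield add mul zero one /\ #|R| = n.
Proof.
case: n hn => [|[|m]] // _.
(* Here [n = m.+2], so the cyclic group ['I_m.+1] has order [n - 1]; it is trivial when [n = 2]. *)
exists (option 'I_m.+1), (@hadd 'I_m.+1), (@hmul 'I_m.+1), None, (Some 0%R).
split; first exact: adjoin_zero_hyperfield.
by rewrite card_option card_ord.
Qed.
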